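(* Let $\mathcal{T}$ be the set of probability densities on $\mathbb{R}^d$ with respect to Lebesgue measure, endowed with the $L^1$ norm $\|\cdot\|_1$. (i) If $f\in\mathcal{T}$ satisfies $\mathrm{reach}(\mathrm{supp}(f))>0$, then for every $\delta>0$ there exists $f_\delta\in\mathcal{T}$ with $\|f-f_\delta\|_1<\delta$ and $\mathrm{reach}(\mathrm{supp}(f_\delta))=0$. (ii) If $f\in\mathcal{T}$ satisfies $\mathrm{reach}(\mathrm{supp}(f))=0$, then for every $\varepsilon>0$ there exists $f_\varepsilon\in\mathcal{T}$ with $\|f-f_\varepsilon\|_1<\varepsilon$ and $\mathrm{reach}(\mathrm{supp}(f_\varepsilon))>0$. Consequently the functional $\alpha:\mathcal{T}\to\{0,1\}$, $\alpha(f)=1$ if $\mathrm{reach}(\mathrm{supp}(f))=0$ and $\alpha(f)=0$ otherwise, is discontinuous (in $\|\cdot\|_1$) at every $f\in\mathcal{T}$, and therefore $\alpha$ is not consistently estimable on $\mathcal{T}$ from i.i.d. samples.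
   Context: $\mathrm{supp}(f)$ is the support of the density $f$. For a set $M\subset\mathbb{R}^d$, $\mathrm{Unp}(M)$ is the set of points of $\mathbb{R}^d$ having a unique closest point in $M$; for $x\in M$, $\mathrm{reach}(M,x)=\sup\{r>0:\mathring{\mathcal{B}}(x,r)\subset\mathrm{Unp}(M)\}$ with $\mathring{\mathcal{B}}$ the open Euclidean ball, and $\mathrm{reach}(M)=\inf_{x\in M}\mathrm{reach}(M,x)$. A functional $\Phi$ on $\mathcal{T}$ is consistently estimable if there exist estimators $T_n=T_n(X_1,\dots,X_n)$ such that for every $f\in\mathcal{T}$, $T_n\to\Phi(f)$ in probability when $X_1,X_2,\dots$ are i.i.d. with density $f$. *)

(* Defs.v *)
From HB Require Import structures.
From mathcomp Require Import all_boot all_order all_algebra.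
From mathcomp Require Import all_classical all_reals all_analysis.
Set Implicit Arguments. Unset Strict Implicit. Unset Printing Implicit Defensive.
Import Order.TTheory GRing.Theory Num.Theory.
Import numFieldNormedType.Exports.
Local Open Scope classical_set_scope.
Local Open Scope ring_scope.

Section Defs.
Variable R : realType.

Fixpoint tint {T : Type} (I : (T -> \bar R) -> \bar R) (n : nat)
  : (n.-tuple T -> \bar R) -> \bar R :=
  match n return (n.-tuple T -> \bar R) -> \bar R with
  | 0 => fun g => g [tuple]
  | n'.+1 => fun g => I (fun x => @tint T I n' (fun t => g (cons_tuple x t)))
  end.

Definition leb_int (g : R -> \bar R) : \bar R :=
  (\int[@lebesgue_measure R]_x g x)%E.

(* Points of R^d are d-tuples of reals (measurable structure: product
   sigma-algebra = Borel sets of R^d).  [lint d g] is the Lebesgue integral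
   over R^d of a nonnegative measurable g, computed as an iterated integral
   (Tonelli). *)
Definition lint (d : nat) : (d.-tuple R -> \bar R) -> \bar R :=
  @tint _ leb_int d.

Definition edist (d : nat) (x y : d.-tuple R) : R :=
  Num.sqrt (\sum_(i < d) (tnth x i - tnth y i) ^+ 2).

Definition oball (d : nat) (x : d.-tuple R) (r : R) : set (d.-tuple R) :=
  [set y | edist x y < r].

Definition is_density (d : nat) (f : d.-tuple R -> R) : Prop :=
  [/\ measurable_fun setT f, (forall x, 0 <= f x)
    & lint (fun x => (f x)%:E) = 1%E].

Definition L1dist (d : nat) (f g : d.-tuple R -> R) : \bar R :=
  lint (fun x => `|f x - g x|%:E).

(* Support of (the measure with) density f: points every open ball around
   which has positive f-mass (the smallest closed set of full mass). *)
Definition supp (d : nat) (f : d.-tuple R -> R) : set (d.-tuple R) :=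
  [set x | forall r : R, 0 < r ->
     (0 < lint (fun y => (if edist x y < r then f y else 0)%:E))%E].

Definition Unp (d : nat) (M : set (d.-tuple R)) : set (d.-tuple R) :=
  [set x | exists! y, M y /\ (forall z, M z -> edist x y <= edist x z)].

(* reach(M,x) = sup{r : B(x,r) open ball in Unp(M)}; allowing r = 0 (empty
   ball) gives the convention sup of the empty set of positive radii = 0. *)
Definition reach_at (d : nat) (M : set (d.-tuple R)) (x : d.-tuple R) : \bar R :=
  ereal_sup [set r%:E | r in [set r : R | 0 <= r /\ oball x r `<=` Unp M]].

Definition reach (d : nat) (M : set (d.-tuple R)) : \bar R :=
  ereal_inf [set reach_at M x | x in M].

Definition alpha (d : nat) (f : d.-tuple R -> R) : R :=
  if reach (supp f) == 0%E then 1 else 0.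

(* Consistent estimability of Phi on the set of densities: measurable
   estimators T_n of the sample (X_1,...,X_n) in (R^d)^n such that, for every
   density f, T_n(X_1..X_n) -> Phi f in probability when X_i are iid with
   density f, i.e. the joint law has density prod_i f(x_i). *)
Definition consistently_estimable (d : nat) (Phi : (d.-tuple R -> R) -> R)
  : Prop :=
  exists T : forall n : nat, n.-tuple (d.-tuple R) -> R,
    (forall n, measurable_fun setT (T n)) /\
    forall f, is_density f -> forall eps : R, 0 < eps ->
      ((fun n => @tint _ (@lint d) n
          (fun xs => (if eps < `|T n xs - Phi f| then \prod_(i < n) f (tnth xs i)
                       else 0)%:E))
        @ \oo --> 0%E).

End Defs.

(* Main.v *)
(** Adding a little Gaussian makes a density positive everywhere, so that its
    support is the whole space and has infinite reach. Conversely, remove from a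
    positive density the slabs [1/(2k+2) < x_0 < 1/(2k+1)], [k >= m], whose mass
    tends to 0 with [m]: the midpoint of a removed slab has two nearest points
    in the remaining support, and these midpoints accumulate at the origin, so
    the reach vanishes.

    Against consistent estimation, choose densities [f_k] with alternating
    values of [alpha] and sample sizes [n_k >= k] at which the estimator is
    accurate under [f_k] with probability [> 3/4], the [L^1] increments being so
    small that the limit [f] satisfies [n_k * ||f - f_k|| <= 1/4]. The law of an
    [n]-sample is [n]-Lipschitz in the density, so under [f] the estimator is
    close to both values of [alpha] infinitely often. *)

Require Import Defs.
From HB Require Import structures.
From mathcomp Require Import all_boot all_order all_algebra.
From mathcomp Require Import all_classical all_reals all_analysis.
From mathcomp Require Import measurable_realfun lra.
Import Order.TTheory GRing.Theory Num.Theory.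
Import numFieldNormedType.Exports.
(* [edist] is otherwise shadowed by the extended distance of the library. *)
Import Defs.
Local Open Scope classical_set_scope.
Local Open Scope ring_scope.

Set Implicit Arguments.
Unset Strict Implicit.
Unset Printing Implicit Defensive.

(** * Iterated integrals as integrals over tuples *)

(** [tint] and [lint] are recursive functionals; this predicate ties them to a measure, which gives
    access to the convergence theorems. It speaks of nonnegative measurable integrands, the ones
    covered by Tonelli. *)
Definition represents d (T : measurableType d) (R : realType)
    (I : (T -> \bar R) -> \bar R) (mu : set T -> \bar R) : Prop :=
  forall g : T -> \bar R, measurable_fun setT g -> (forall x, (0 <= g x)%E) ->
    I g = (\int[mu]_x g x)%E.

Lemma measurable_cons_pair d (T : measurableType d) n :
  measurable_fun [set: (T * n.-tuple T)%type] (fun p => cons_tuple p.1 p.2).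
Proof. exact: measurable_cons. Qed.

Lemma measurable_cons_tuple d (T : measurableType d) n (x : T) :
  measurable_fun [set: n.-tuple T] (fun t => cons_tuple x t).
Proof. exact: measurable_cons. Qed.

(* The canonical structure for [m1 \x m2] is only found for probabilities. *)
Lemma product_sigma_finite d1 d2 (T1 : measurableType d1)
    (T2 : measurableType d2) (R : realType)
    (m1 : {sigma_finite_measure set T1 -> \bar R})
    (m2 : {sigma_finite_measure set T2 -> \bar R}) :
  sigma_finite setT (m1 \x m2)%E.
Proof.
have /sigma_finiteP[F [FT ndF Foo]] := sigma_finiteT m1.
have /sigma_finiteP[G [GT ndG Goo]] := sigma_finiteT m2.
exists (fun n => F n `*` G n).
  apply/esym/seteqP; split=> // -[x y] _.
  have [n _ Fx] : (\bigcup_i F i) x by rewrite -FT.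
  have [m _ Gy] : (\bigcup_i G i) y by rewrite -GT.
  exists (maxn n m) => //; split.
  - by move: Fx; exact/subsetPset/ndF/leq_maxl.
  - by move: Gy; exact/subsetPset/ndG/leq_maxr.
move=> k; have [mF Fk] := Foo k; have [mG Gk] := Goo k.
split; first exact: measurableX.
by rewrite product_measure1E// lte_mul_pinfty// ge0_fin_numE.
Qed.

(** Splitting a tuple into head and tail is a measurable inverse of consing, so an exhaustion of the
    product pulls back to one of the space of tuples. *)
Lemma pushforward_cons_sigma_finite d (T : measurableType d) (R : realType) n
    (m : {measure set (T * n.-tuple T)%type -> \bar R}) :
  sigma_finite setT m ->
  sigma_finite setT
    (pushforward m (fun p : (T * n.-tuple T)%type => cons_tuple p.1 p.2)).
Proof.
move=> [F FT Foo].
pose u (t : n.+1.-tuple T) := (tnth t ord0, [tuple of behead t]).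
have mu : measurable_fun setT u.
  apply/measurable_fun_pairP; split; first exact: measurable_tnth.
  exact: measurable_behead.
have uK p : u (cons_tuple p.1 p.2) = p.
  case: p => x t; rewrite /u/= tnth0; congr pair.
  exact/val_inj.
exists (fun k => u @^-1` F k); first by rewrite -preimage_bigcup -FT preimage_setT.
move=> k; have [mF Fk] := Foo k; split.
  by rewrite -[X in measurable X]setTI; exact: mu.
rewrite /pushforward (_ : _ @^-1` _ = F k)//.
by apply/seteqP; split=> p /=; rewrite uK.
Qed.

(** By induction: the Dirac mass at the empty tuple, then the image of [mu \x nu] under consing.
    Sigma-finiteness is carried along because Tonelli asks for it. *)
Lemma tint_represents d (T : measurableType d) (R : realType)
    (I : (T -> \bar R) -> \bar R) (mu : {sigma_finite_measure set T -> \bar R}) :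
  represents I mu ->
  forall n, exists nu : {sigma_finite_measure set (n.-tuple T) -> \bar R},
    represents (@tint R T I n) nu.
Proof.
move=> Imu; elim => [|n [nu Hnu]].
  exists \d_([tuple] : 0.-tuple T) => g mg g0.
  by rewrite integral_dirac//= diracT mul1e.
pose c := fun p : (T * n.-tuple T)%type => cons_tuple p.1 p.2.
have mc : measurable_fun setT c by exact: measurable_cons_pair.
pose m : {measure set (T * n.-tuple T)%type -> \bar R} := (mu \x nu)%E.
have sfm := pushforward_cons_sigma_finite
  (product_sigma_finite mu nu : sigma_finite setT m).
pose pm' := HB.pack_for (Measure.type (n.+1.-tuple T) R) (pushforward m c).
pose pm := pm' mc.
pose H := @Measure_isSigmaFinite.Build _ _ _ pm sfm.
pose nu' : {sigma_finite_measure set (n.+1.-tuple T) -> \bar R} :=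
  HB.pack_for (SigmaFiniteMeasure.type (n.+1.-tuple T) R) (Measure.sort pm) H.
exists nu' => g mg g0.
have mgc : measurable_fun setT (g \o c) by exact: measurableT_comp.
rewrite [RHS](ge0_integral_pushforward mc m)//.
have gc0 p : (0 <= (g \o c) p)%E by exact: g0.
rewrite preimage_setT (fubini_tonelli1 (g \o c) mgc gc0).
rewrite -Imu.
- change (I (fun x => tint I (fun t => g (cons_tuple x t))) = I (fubini_F nu (g \o c))).
  congr I; apply/funext => x; rewrite Hnu//.
  by apply: measurableT_comp => //; exact: measurable_cons_tuple.
- exact: measurable_fun_fubini_tonelli_F.
- by move=> x; exact: integral_ge0.
Qed.

Lemma tintS (T : Type) (R : realType) (I : (T -> \bar R) -> \bar R) n
    (g : n.+1.-tuple T -> \bar R) :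
  tint I g = I (fun x => tint I (fun t => g (cons_tuple x t))).
Proof. by []. Qed.

Section represents_theory.
Context d (T : measurableType d) (R : realType).
Context (I : (T -> \bar R) -> \bar R) (mu : {measure set T -> \bar R}).
Hypothesis Imu : represents I mu.
Implicit Types f g : T -> R.

Lemma representsE f : measurable_fun setT f -> (forall x, 0 <= f x) ->
  I (fun x => (f x)%:E) = (\int[mu]_x (f x)%:E)%E.
Proof.
by move=> mf f0; rewrite Imu//; exact/measurable_EFinP.
Qed.

Lemma represents_ge0 f : measurable_fun setT f -> (forall x, 0 <= f x) ->
  (0 <= I (fun x => (f x)%:E))%E.
Proof.
by move=> mf f0; rewrite representsE//; apply: integral_ge0 => x _; rewrite lee_fin.
Qed.

Lemma represents_le f g : measurable_fun setT f -> measurable_fun setT g ->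
  (forall x, 0 <= f x) -> (forall x, f x <= g x) ->
  (I (fun x => (f x)%:E) <= I (fun x => (g x)%:E))%E.
Proof.
move=> mf mg f0 fg; rewrite !representsE//; last first.
  by move=> x; exact: le_trans (fg x).
apply: ge0_le_integral => // [x _|||x _]; rewrite ?lee_fin//;
  exact/measurable_EFinP.
Qed.

Lemma representsD f g : measurable_fun setT f -> measurable_fun setT g ->
  (forall x, 0 <= f x) -> (forall x, 0 <= g x) ->
  I (fun x => (f x + g x)%:E) = (I (fun x => (f x)%:E) + I (fun x => (g x)%:E))%E.
Proof.
move=> mf mg f0 g0; rewrite !representsE//; last 2 first.
- exact: measurable_funD.
- by move=> x; rewrite addr_ge0.
under eq_integral do rewrite EFinD.
rewrite ge0_integralD// => [x _||x _|]; rewrite ?lee_fin//;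
  exact/measurable_EFinP.
Qed.

Lemma representsZ (k : R) f : measurable_fun setT f -> (forall x, 0 <= f x) ->
  0 <= k -> I (fun x => (k * f x)%:E) = (k%:E * I (fun x => (f x)%:E))%E.
Proof.
move=> mf f0 k0; rewrite !representsE//; last 2 first.
- exact: measurable_funM.
- by move=> x; rewrite mulr_ge0.
under eq_integral do rewrite EFinM.
rewrite ge0_integralZl_EFin// => [x _|]; first by rewrite lee_fin.
exact/measurable_EFinP.
Qed.

(** Were the integral zero, [f] would vanish off a null set, which would then contain [A]. *)
Lemma represents_gt0 f (A : set T) : measurable_fun setT f ->
  (forall x, 0 <= f x) -> measurable A -> (0 < mu A)%E ->
  (forall x, A x -> 0 < f x) -> (0 < I (fun x => (f x)%:E))%E.
Proof.
move=> mf f0 mA muA fA; rewrite lt0e represents_ge0// andbT.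
apply/negP => /eqP; rewrite representsE// => f_eq0.
have : (\int[mu]_x `|(f x)%:E| = 0)%E.
  by rewrite -[RHS]f_eq0; apply: eq_integral => x _; rewrite gee0_abs// lee_fin.
have mfE := (measurable_EFinP setT f).2 mf.
move/(ae_eq_integral_abs mu measurableT mfE) => [N [mN N0 subN]].
have AN : A `<=` N.
  move=> x Ax; apply: subN => /= /(_ Logic.I) [] /eqP.
  by rewrite gt_eqF// fA.
by move: muA; rewrite ltNge -N0 le_measure// inE.
Qed.

End represents_theory.

(** * Product integrands on tuples *)

Lemma behead_cons_tuple n (T : Type) (x : T) (t : n.-tuple T) :
  [tuple of behead (cons_tuple x t)] = t.
Proof. exact/val_inj. Qed.

Lemma tint_cons_mul d (T : measurableType d) (R : realType)
    (I : (T -> \bar R) -> \bar R) (mu : {measure set T -> \bar R}) n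
    (nu : {measure set (n.-tuple T) -> \bar R})
    (a : T -> R) (b : n.-tuple T -> R) :
  represents I mu -> represents (@tint R T I n) nu ->
  measurable_fun setT a -> (forall x, 0 <= a x) ->
  measurable_fun setT b -> (forall x, 0 <= b x) ->
  tint I (fun t : n.+1.-tuple T =>
    (a (tnth t ord0) * b [tuple of behead t])%:E) =
  (I (fun x => (a x)%:E) * tint I (fun t => (b t)%:E))%E.
Proof.
move=> Imu Hnu ma a0 mb b0; rewrite tintS.
have -> : (fun x : T => tint I (fun t : n.-tuple T =>
    (a (tnth (cons_tuple x t) ord0) *
     b [tuple of behead (cons_tuple x t)])%:E)) =
    fun x => ((a x)%:E * tint I (fun t : n.-tuple T => (b t)%:E))%E.
  apply/funext => x; rewrite -(representsZ Hnu)//.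
  congr (tint I); apply/funext => t.
  by rewrite tnth0 behead_cons_tuple.
have tb0 := represents_ge0 Hnu mb b0.
have ma' := (measurable_EFinP setT a).2 ma.
rewrite Imu; last 2 first.
- exact: emeasurable_funM.
- by move=> x; rewrite mule_ge0// lee_fin.
by rewrite ge0_integralZr// -?(representsE Imu)// => x _; rewrite lee_fin.
Qed.

Lemma measurable_tnth_prod d (T : measurableType d) (R : realType) n
    (h : 'I_n -> T -> R) : (forall i, measurable_fun setT (h i)) ->
  measurable_fun setT (fun t : n.-tuple T => \prod_(i < n) h i (tnth t i)).
Proof.
move=> mh; apply: measurable_prod => i _.
by apply: (measurableT_comp (mh i)); exact: measurable_tnth.
Qed.

Lemma prod_tupleS (T : Type) (R : realType) n (h : 'I_n.+1 -> T -> R)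
    (t : n.+1.-tuple T) :
  \prod_(i < n.+1) h i (tnth t i) =
  h ord0 (tnth t ord0) *
  \prod_(i < n) h (lift ord0 i) (tnth [tuple of behead t] i).
Proof.
rewrite big_ord_recl; congr (_ * _); apply: eq_bigr => i _.
by rewrite [in LHS](tuple_eta t) tnthS.
Qed.

(** Serves both for the mass of a product density and for the volume of a cube. *)
Lemma tint_prod d (T : measurableType d) (R : realType)
    (I : (T -> \bar R) -> \bar R) (mu : {sigma_finite_measure set T -> \bar R})
    n (h : 'I_n -> T -> R) (c : 'I_n -> R) :
  represents I mu ->
  (forall i, measurable_fun setT (h i)) -> (forall i x, 0 <= h i x) ->
  (forall i, I (fun x => (h i x)%:E) = (c i)%:E) ->
  tint I (fun t : n.-tuple T => (\prod_(i < n) h i (tnth t i))%:E) =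
  (\prod_(i < n) c i)%:E.
Proof.
move=> Imu; elim: n h c => [|n IHn] h c mh h0 hc.
  by rewrite /= !big_ord0.
have [nu Hnu] := tint_represents Imu n.
under [X in tint I X]funext do rewrite prod_tupleS.
rewrite (tint_cons_mul (a := h ord0)
  (b := fun t => \prod_(i < n) h (lift ord0 i) (tnth t i)) Imu Hnu)//; last 2 first.
- exact: (measurable_tnth_prod (h := fun i => h (lift ord0 i))).
- by move=> t /=; apply: prodr_ge0 => i _.
by rewrite hc (IHn (fun i => h (lift ord0 i)) (fun i => c (lift ord0 i)))//
  big_ord_recl.
Qed.

Lemma tint_prod_density d (T : measurableType d) (R : realType)
    (I : (T -> \bar R) -> \bar R) (mu : {sigma_finite_measure set T -> \bar R})
    n (f : T -> R) :
  represents I mu -> measurable_fun setT f -> (forall x, 0 <= f x) ->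
  I (fun x => (f x)%:E) = 1%E ->
  tint I (fun t : n.-tuple T => (\prod_(i < n) f (tnth t i))%:E) = 1%E.
Proof.
move=> Imu mf f0 f1.
have := tint_prod (n := n) (h := fun=> f) (c := fun=> 1) Imu.
by rewrite big1//; exact.
Qed.

(** One coordinate is exchanged at a time: [a * F - b * G = (a - b) * F + b * (F - G)]. Since [F]
    and [g] have mass one, the first term contributes at most [l] and the second the bound for [n]
    coordinates. *)
Lemma tint_prod_dist d (T : measurableType d) (R : realType)
    (I : (T -> \bar R) -> \bar R) (mu : {sigma_finite_measure set T -> \bar R})
    (f g : T -> R) (l : R) n :
  represents I mu ->
  measurable_fun setT f -> (forall x, 0 <= f x) -> I (fun x => (f x)%:E) = 1%E ->
  measurable_fun setT g -> (forall x, 0 <= g x) -> I (fun x => (g x)%:E) = 1%E ->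
  (I (fun x => `|f x - g x|%:E) <= l%:E)%E ->
  (tint I (fun t : n.-tuple T =>
    `|\prod_(i < n) f (tnth t i) - \prod_(i < n) g (tnth t i)|%:E)
    <= (n%:R * l)%:E)%E.
Proof.
move=> Imu mf f0 f1 mg g0 g1 fgl; elim: n => [|n IHn].
  by rewrite /= !big_ord0 subrr normr0 mul0r.
have [nu Hnu] := tint_represents Imu n.
have [nu' Hnu'] := tint_represents Imu n.+1.
have mfg : measurable_fun setT (fun x => `|f x - g x|).
  by apply: measurableT_comp => //; exact: measurable_funB.
have mF m : measurable_fun setT (fun t : m.-tuple T => \prod_(i < m) f (tnth t i)).
  exact: (measurable_tnth_prod (h := fun=> f)).
have mG m : measurable_fun setT (fun t : m.-tuple T => \prod_(i < m) g (tnth t i)).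
  exact: (measurable_tnth_prod (h := fun=> g)).
have mFG m : measurable_fun setT (fun t : m.-tuple T =>
    `|\prod_(i < m) f (tnth t i) - \prod_(i < m) g (tnth t i)|).
  by apply: measurableT_comp => //; exact: measurable_funB (mF m) (mG m).
have mbh : measurable_fun setT (fun t : n.+1.-tuple T => [tuple of behead t]).
  exact: measurable_behead.
have mhd : measurable_fun setT (fun t : n.+1.-tuple T => tnth t ord0).
  exact: measurable_tnth.
pose u (t : n.+1.-tuple T) := `|f (tnth t ord0) - g (tnth t ord0)| *
  \prod_(i < n) f (tnth [tuple of behead t] i).
pose v (t : n.+1.-tuple T) := g (tnth t ord0) *
  `|\prod_(i < n) f (tnth [tuple of behead t] i) -
    \prod_(i < n) g (tnth [tuple of behead t] i)|.
have mu' : measurable_fun setT u.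
  apply: measurable_funM; first exact: (measurableT_comp mfg mhd).
  exact: (measurableT_comp (mF n) mbh).
have mv : measurable_fun setT v.
  apply: measurable_funM; first exact: (measurableT_comp mg mhd).
  exact: (measurableT_comp (mFG n) mbh).
have u0 t : 0 <= u t by rewrite mulr_ge0// prodr_ge0.
have v0 t : 0 <= v t by rewrite mulr_ge0.
apply: (@le_trans _ _ (tint I (fun t : n.+1.-tuple T => (u t + v t)%:E))).
  apply: (represents_le Hnu' (mFG n.+1) (measurable_funD mu' mv)) => //.
  move=> t; rewrite !(prod_tupleS (fun=> _)) /u /v.
  set a := f _; set b := g _; set F := \prod_(i < n) _; set G := \prod_(i < n) _.
  have -> : a * F - b * G = (a - b) * F + b * (F - G).
    by rewrite mulrBl mulrBr addrA subrK.
  have F0 : 0 <= F by apply: prodr_ge0 => i _.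
  rewrite (le_trans (ler_normD _ _))// !normrM.
  by rewrite (ger0_norm F0) (ger0_norm (g0 _)).
rewrite (representsD Hnu')//.
rewrite (tint_cons_mul (a := fun x => `|f x - g x|)
  (b := fun t => \prod_(i < n) f (tnth t i)) Imu Hnu)//; last first.
  by move=> t /=; apply: prodr_ge0 => i _.
rewrite (tint_cons_mul (a := g) (b := fun t =>
  `|\prod_(i < n) f (tnth t i) - \prod_(i < n) g (tnth t i)|) Imu Hnu)//.
rewrite (tint_prod_density _ Imu)// mule1 g1 mul1e.
by rewrite -natr1 mulrDl mul1r addrC EFinD leeD.
Qed.

(* [lebesgue_measure] lives on an alias of [R] carrying another display, hence
   the push-forward along the identity. *)
Lemma leb_int_represents (R : realType) :
  exists lam : {sigma_finite_measure set R -> \bar R}, represents (@leb_int R) lam.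
Proof.
pose id : measurableTypeR R -> R := idfun.
have mid : measurable_fun setT id by move=> _ A mA; rewrite setTI.
have sfid : sigma_finite setT (pushforward (@lebesgue_measure R) id).
  have [F FT Foo] := sigma_finiteT (@lebesgue_measure R).
  by exists F => // k; have [mF Fk] := Foo k; split.
pose pm' := HB.pack_for (Measure.type R R) (pushforward (@lebesgue_measure R) id).
pose pm := pm' mid.
pose H := @Measure_isSigmaFinite.Build _ _ _ pm sfid.
pose lam : {sigma_finite_measure set R -> \bar R} :=
  HB.pack_for (SigmaFiniteMeasure.type R R) (Measure.sort pm) H.
exists lam => g mg g0.
by rewrite [RHS](ge0_integral_pushforward mid (@lebesgue_measure R)).
Qed.

Lemma lint_represents (R : realType) d :
  exists nu : {sigma_finite_measure set (d.-tuple R) -> \bar R},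
    represents (@lint R d) nu.
Proof.
have [lam Hlam] := leb_int_represents R.
exact: (tint_represents Hlam d).
Qed.

Lemma measurable_coord (R : realType) d (i : 'I_d) :
  measurable_fun [set: d.-tuple R] (fun y => tnth y i).
Proof. exact: measurable_tnth. Qed.

(** * Euclidean balls and cubes *)

Section edist.
Context (R : realType) (d : nat).
Implicit Types (x y : d.-tuple R) (r : R).

Lemma edist_ge0 x y : 0 <= edist x y.
Proof. exact: sqrtr_ge0. Qed.

Lemma coord_le_edist x y i : `|tnth x i - tnth y i| <= edist x y.
Proof.
rewrite -sqrtr_sqr ler_sqrt; last by apply: sumr_ge0 => j _; exact: sqr_ge0.
rewrite (bigD1 i)//= lerDl; apply: sumr_ge0 => j _; exact: sqr_ge0.
Qed.

Lemma edist_le_cube x y r : (forall i, `|tnth x i - tnth y i| <= r) ->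
  edist x y <= d%:R * r.
Proof.
(* The sign of [r] is only known through some coordinate; in dimension 0 both sides are 0. *)
case: d x y => [|n] x y xyr; first by rewrite /edist big_ord0 sqrtr0 mul0r.
have r0 : 0 <= r := le_trans (normr_ge0 _) (xyr ord0).
rewrite -[leRHS]ger0_norm ?mulr_ge0// -sqrtr_sqr ler_sqrt ?sqr_ge0//.
apply: (@le_trans _ _ (\sum_(i < n.+1) r ^+ 2)).
  apply: ler_sum => i _; rewrite -real_normK ?num_real//.
  by rewrite lerXn2r// nnegrE.
rewrite sumr_const card_ord -[leLHS]mulr_natl exprMn ler_wpM2r ?sqr_ge0//.
by rewrite expr2 -natrM ler_nat leq_pmulr.
Qed.

Lemma edist0_eq x y : edist x y <= 0 -> x = y.
Proof.
move=> xy0; apply: eq_from_tnth => i; apply/eqP; rewrite -subr_eq0 -normr_le0.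
exact: le_trans (coord_le_edist _ _ _) xy0.
Qed.

Lemma edistxx x : edist x x = 0.
Proof. by rewrite /edist big1 ?sqrtr0// => i _; rewrite subrr expr0n. Qed.

Lemma measurable_edist x : measurable_fun setT (edist x).
Proof.
apply: measurableT_comp.
  exact: (continuous_measurable_fun (@sqrt_continuous R)).
apply: measurable_sum => i; apply: measurable_funX.
by apply: measurable_funB => //; exact: measurable_coord.
Qed.

(** The open ball of the sup norm: its indicator is a product over the coordinates, so its measure
    comes from [tint_prod]. *)
Definition cube x r := [set y | forall i, `|tnth x i - tnth y i| < r].

(** Dividing by [d.+1] makes [d * (r / d.+1) < r] strict, also for [d = 0]. *)
Lemma sub_cube_oball x r : 0 < r -> cube x (r / d.+1%:R) `<=` oball x r.
Proof.
move=> r0 y xy; rewrite /oball /=.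
have /edist_le_cube/le_lt_trans : forall i, `|tnth x i - tnth y i| <= r / d.+1%:R.
  by move=> i; exact: ltW.
apply; rewrite mulrCA gtr_pMr// ltr_pdivrMr ?mul1r ?ltr_nat//.
Qed.

Lemma prod_indic_cube x r y :
  \prod_(i < d) \1_(ball (tnth x i) r) (tnth y i) = \1_(cube x r) y :> R.
Proof.
rewrite [RHS]indicE; have [/set_mem xy|xy] := boolP (y \in cube x r).
  by apply: big1 => i _; rewrite indicE mem_set//; exact: xy.
have [i xyi] : exists i, ~ `|tnth x i - tnth y i| < r.
  by apply/existsNP => xy'; move: xy; rewrite mem_set.
by rewrite (bigD1 i)//= indicE memNset// mul0r.
Qed.

Lemma measurable_cube x r : measurable (cube x r).
Proof.
rewrite (_ : cube x r = \bigcap_(i in [set: 'I_d])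
    ((fun y => tnth y i) @^-1` ball (tnth x i) r)).
  apply: fin_bigcap_measurable => // i _.
  rewrite -[X in measurable X]setTI.
  by apply: (measurable_coord i) => //; exact: measurable_ball.
by apply/seteqP; split=> y /= xy => [i _|i]; exact: xy.
Qed.

(** The measure is the product of [d] interval lengths [r *+ 2]. *)
Lemma cube_gt0 (nu : {measure set (d.-tuple R) -> \bar R}) x r :
  represents (@lint R d) nu -> 0 < r -> (0 < nu (cube x r))%E.
Proof.
move=> Hnu r0; rewrite -[cube x r]setIT -integral_indic//; last first.
  exact: measurable_cube.
rewrite -(representsE Hnu)//; last by apply: measurable_indic; exact: measurable_cube.
under [X in lint X]funext do rewrite -prod_indic_cube.
have [lam Hlam] := leb_int_represents R.
have := @tint_prod _ _ _ _ _ d (fun i => \1_(ball (tnth x i) r)) (fun=> r *+ 2)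
  Hlam.
rewrite /lint => ->//.
- by rewrite lte_fin prodr_gt0// => i _; rewrite pmulrn_lgt0.
- by move=> i; apply: measurable_indic; exact: measurable_ball.
- move=> i; rewrite /leb_int integral_indic//; last exact: measurable_ball.
  by rewrite setIT; exact: lebesgue_measure_ball (ltW r0).
Qed.

End edist.

(** * Perturbation of densities, support and reach *)

Section densities.
Context (R : realType) (d : nat).
Implicit Types (f g h : d.-tuple R -> R) (x y : d.-tuple R) (A : set (d.-tuple R)).

Lemma measurable_L1 f g : measurable_fun setT f -> measurable_fun setT g ->
  measurable_fun setT (fun x => `|f x - g x|).
Proof.
by move=> mf mg; apply: measurableT_comp => //; exact: measurable_funB.
Qed.

Lemma L1dist_triangle f g h : measurable_fun setT f -> measurable_fun setT g ->
  measurable_fun setT h -> (L1dist f h <= L1dist f g + L1dist g h)%E.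
Proof.
move=> mf mg mh; have [nu Hnu] := lint_represents R d.
have mfg := measurable_L1 mf mg; have mgh := measurable_L1 mg mh.
rewrite /L1dist -(representsD Hnu)//.
apply: (represents_le Hnu) => //; first exact: measurable_L1.
  exact: measurable_funD.
by move=> x; exact: ler_distD.
Qed.

(** The difference from [f] is [t * (f - g)], and both densities have mass one. *)
Lemma mix_density f g (t : R) : is_density f -> is_density g -> 0 <= t <= 1 ->
  is_density (fun x => (1 - t) * f x + t * g x) /\
  (L1dist f (fun x => (1 - t) * f x + t * g x)%R <= (2 * t)%:E)%E.
Proof.
move=> [mf f0 f1] [mg g0 g1] /andP[t0 t1]; have [nu Hnu] := lint_represents R d.
have s0 : 0 <= 1 - t by rewrite subr_ge0.
have mZ (k : R) (u : d.-tuple R -> R) : measurable_fun setT u ->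
    measurable_fun setT (fun x => k * u x).
  by move=> mu; exact: measurable_funM.
have m_mix : measurable_fun setT (fun x => (1 - t) * f x + t * g x).
  by apply: measurable_funD; exact: mZ.
split; first split => //.
- by move=> x; rewrite addr_ge0// mulr_ge0.
- rewrite (representsD Hnu (mZ _ _ mf) (mZ _ _ mg)); last 2 first.
  + by move=> x; rewrite mulr_ge0.
  + by move=> x; rewrite mulr_ge0.
  rewrite !(representsZ Hnu)//.
  by rewrite f1 g1 !mule1 -EFinD subrK.
apply: (@le_trans _ _ (lint (fun x => (t * f x + t * g x)%:E))).
  apply: (represents_le Hnu) => //; first exact: measurable_L1.
    by apply: measurable_funD; exact: mZ.
  move=> x; have -> : f x - ((1 - t) * f x + t * g x) = t * f x - t * g x.
    by rewrite opprD addrA mulrBl mul1r subKr.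
  by rewrite (le_trans (ler_normB _ _))// !ger0_norm ?mulr_ge0.
rewrite (representsD Hnu (mZ _ _ mf) (mZ _ _ mg)); last 2 first.
- by move=> x; rewrite mulr_ge0.
- by move=> x; rewrite mulr_ge0.
rewrite !(representsZ Hnu)//.
by rewrite f1 g1 !mule1 -EFinD mulrDl mul1r.
Qed.

(** This is conditioning on the complement of [A]. The distance collects the mass [m] lost on [A]
    and the mass gained outside, where [1 - m] is scaled up to 1: again [m]. *)
Lemma restrict_density f A (m : R) : is_density f -> measurable A ->
  lint (fun x => (f x * \1_A x)%:E) = m%:E -> m < 1 ->
  is_density (fun x => (1 - m)^-1 * (f x * \1_(~` A) x)) /\
  (L1dist f (fun x => (1 - m)^-1 * (f x * \1_(~` A) x))%R <= (2 * m)%:E)%E.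
Proof.
move=> [mf f0 f1] mA fA m1; have [nu Hnu] := lint_represents R d.
have k0 : 0 < 1 - m by rewrite subr_gt0.
have ind0 B x : 0 <= \1_B x :> R by rewrite indicE.
have mfI B : measurable B -> measurable_fun setT (fun x => f x * \1_B x).
  by move=> mB; apply: measurable_funM => //; exact: measurable_indic.
have fI0 B x : 0 <= f x * \1_B x by rewrite mulr_ge0.
have mAC : measurable (~` A) by exact: measurableC.
have m0 : 0 <= m by rewrite -lee_fin -fA (represents_ge0 Hnu)//; exact: mfI.
have fAC : lint (fun x => (f x * \1_(~` A) x)%:E) = (1 - m)%:E.
  have : (m%:E + lint (fun x => (f x * \1_(~` A) x)%:E) = 1)%E.
    rewrite -fA -(representsD Hnu (mfI _ mA) (mfI _ mAC))// -f1.
    congr lint; apply/funext => x; congr EFin.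
    by rewrite -mulrDr !indicE in_setC; case: (x \in A); rewrite ?addr0 ?add0r mulr1.
  have := represents_ge0 Hnu (mfI _ mAC) (fI0 _).
  case: (lint _) => [r| |]//= _; rewrite -EFinD => -[<-].
  by rewrite addrAC subrr add0r.
have mk (c : R) : measurable_fun setT (fun x => c * (f x * \1_(~` A) x)).
  by apply: measurable_funM => //; exact: mfI.
have ki : 0 <= (1 - m)^-1 - 1.
  by rewrite subr_ge0 invf_ge1// lerBlDr lerDl.
split; first split => //.
- by move=> x; rewrite mulr_ge0// invr_ge0 ltW.
- rewrite (representsZ Hnu (mfI _ mAC))// ?invr_ge0 ?ltW//.
  by rewrite fAC -EFinM mulVf// gt_eqF.
apply: (@le_trans _ _
  (lint (fun x => (f x * \1_A x + ((1 - m)^-1 - 1) * (f x * \1_(~` A) x))%:E))).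
  apply: (represents_le Hnu) => //; first exact: measurable_L1.
    by apply: measurable_funD; [exact: mfI|exact: mk].
  move=> x; rewrite !indicE in_setC; case: (x \in A) => /=.
    by rewrite !mulr0 !mulr1 subr0 addr0 ger0_norm.
  rewrite mulr0 add0r mulr1 distrC -[X in _ - X]mul1r -mulrBl.
  by rewrite ger0_norm// mulr_ge0.
rewrite (representsD Hnu (mfI _ mA) (mk _))//; last first.
  by move=> x; rewrite mulr_ge0.
rewrite (representsZ Hnu (mfI _ mAC))// fA fAC -EFinM -EFinD lee_fin.
by rewrite mulrBl mulVf ?gt_eqF// mul1r subKr mulrDl mul1r.
Qed.

(** * Positive densities, supports and reach *)

Definition gauss x : R := \prod_(i < d) normal_pdf 0 1 (tnth x i).

Lemma normal_pdf_gt0 (t : R) : 0 < normal_pdf 0 1 t.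
Proof.
by rewrite normal_pdfE ?oner_eq0// mulr_gt0 ?expR_gt0// normal_peak_gt0 ?oner_eq0.
Qed.

Lemma gauss_gt0 x : 0 < gauss x.
Proof. by apply: prodr_gt0 => i _; exact: normal_pdf_gt0. Qed.

Lemma gauss_density : is_density gauss.
Proof.
have [lam Hlam] := leb_int_represents R.
split.
- exact: (measurable_tnth_prod (fun=> measurable_normal_pdf 0 1)).
- by move=> x; rewrite ltW// gauss_gt0.
apply: (tint_prod_density d Hlam).
- exact: measurable_normal_pdf.
- by move=> t; rewrite ltW// normal_pdf_gt0.
- exact: integral_normal_pdf.
Qed.

Lemma approx_positive_density f (eps : R) : is_density f -> 0 < eps ->
  exists g, [/\ is_density g, (L1dist f g < eps%:E)%E & forall x, 0 < g x].
Proof.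
(* The bound [2^-1] keeps the weights of the mixture in the unit interval; [eps / 3] makes the
   distance bound [2 * t] strictly less than [eps]. *)
move=> df e0; pose t := Num.min (2^-1) (eps / 3).
have t0 : 0 < t by rewrite lt_min invr_gt0 ltr0n divr_gt0.
have t1 : t <= 1 by rewrite ge_min invf_le1 ?ltr0n// ler1n.
have te : 2 * t < eps.
  rewrite (@le_lt_trans _ _ (2 * (eps / 3)))//.
    by rewrite ler_pM2l// ge_min lexx orbT.
  by rewrite mulrCA gtr_pMr// ltr_pdivrMr// mul1r ltr_nat.
have [|dg fg] := mix_density df gauss_density (t := t); first by rewrite (ltW t0).
exists (fun x => (1 - t) * f x + t * gauss x); split => //.
  by rewrite (le_lt_trans fg)// lte_fin.
case: df => mf f0 f1 x.
by rewrite ltr_wpDl ?mulr_ge0 ?subr_ge0// mulr_gt0// gauss_gt0.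
Qed.

(** The cube may sit anywhere in the ball, not only around [x], so that boundary points of the
    positivity set are covered too. *)
Lemma supp_gt0 f x : measurable_fun setT f -> (forall y, 0 <= f y) ->
  (forall r, 0 < r -> exists z s, [/\ 0 < s, cube z s `<=` oball x r &
    forall y, cube z s y -> 0 < f y]) ->
  supp f x.
Proof.
move=> mf f0 fx r r0; have [nu Hnu] := lint_represents R d.
have [z [s [s0 zx fz]]] := fx r r0.
apply: (represents_gt0 Hnu _ _ (measurable_cube z s) (cube_gt0 z Hnu s0)).
- apply: measurable_fun_ifT => //.
  by apply: measurable_fun_ltr => //; exact: measurable_edist.
- by move=> y; case: ifP.
- by move=> y zy; rewrite (zx y zy)// fz.
Qed.

Lemma supp_full f : is_density f -> (forall x, 0 < f x) -> supp f = setT.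
Proof.
move=> [mf f0 _] fp; apply/seteqP; split => // x _; apply: supp_gt0 => // r r0.
exists x, (r / d.+1%:R); split => //; first by rewrite divr_gt0.
exact: sub_cube_oball.
Qed.

Lemma supp_not0 f x r : 0 < r -> supp f x ->
  exists2 y, edist x y < r & f y != 0.
Proof.
move=> r0 fx; apply: contrapT => nofy; have [nu Hnu] := lint_represents R d.
have := fx r r0; rewrite (_ : (fun y => _) = fun=> (cst 0 x)%:E).
  by rewrite (representsE Hnu)// integral0 ltxx.
apply/funext => y; congr EFin; case: ifPn => // xy.
apply/eqP; apply: contrapT => /negP fy; apply: nofy; by exists y.
Qed.

Lemma reach_ge0 (M : set (d.-tuple R)) : (0 <= reach M)%E.
Proof.
apply: le_ereal_inf_tmp => _ [x Mx <-]; apply: ereal_sup_ubound.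
(* Radius 0 is always admissible, its ball being empty. *)
exists 0 => //; split => // y; rewrite /oball /= => xy.
by have := edist_ge0 x y; rewrite leNgt xy.
Qed.

(** In the whole space every point is its own unique nearest point, so radius 1 is admissible
    everywhere. *)
Lemma reach_setT_gt0 : (0 < reach [set: d.-tuple R])%E.
Proof.
apply: (@lt_le_trans _ _ 1%E) => //.
apply: le_ereal_inf_tmp => _ [x _ <-]; apply: ereal_sup_ubound.
exists 1 => //; split => // y _; exists y; split.
  by split => // z _; rewrite edistxx edist_ge0.
by move=> z [_ /(_ y Logic.I)]; rewrite edistxx => /edist0_eq.
Qed.

Lemma reach_eq0 (M : set (d.-tuple R)) x : M x ->
  (forall r, 0 < r -> exists2 y, edist x y < r & ~ Unp M y) -> reach M = 0%E.
Proof.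
move=> Mx Mr; apply/eqP; rewrite eq_le reach_ge0 andbT.
apply: (@le_trans _ _ (reach_at M x)).
  by apply: ereal_inf_lbound; exists x.
apply: ge_ereal_sup => _ [r [r0 xr] <-]; rewrite lee_fin leNgt; apply/negP => rp.
by have [y xy] := Mr r rp; apply; exact: xr.
Qed.

End densities.

Lemma cvge0_lt (R : realType) (u : nat -> \bar R) (e : R) :
  u @ \oo --> 0%E -> 0 < e -> \forall n \near \oo, (u n < e%:E)%E.
Proof.
move=> /fine_cvgP[ufin u0] e0.
have ue := cvgr_lt _ u0 _ e0; near=> n.
rewrite -[u n]fineK; last by near: n.
by rewrite lte_fin; near: n; exact: ue.
Unshelve. all: by end_near. Qed.

(** Dominated convergence with [f] as the dominating function: each point eventually leaves the sets
    [A n]. *)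
Lemma lint_shrinking (R : realType) d (f : d.-tuple R -> R)
    (A : nat -> set (d.-tuple R)) :
  is_density f -> (forall n, measurable (A n)) ->
  (forall x, \forall n \near \oo, ~ A n x) ->
  (fun n => lint (fun x => (f x * \1_(A n) x)%:E)) @ \oo --> 0%E.
Proof.
move=> [mf f0 f1] mA Ax; have [nu Hnu] := lint_represents R d.
have mfA n : measurable_fun setT (fun x => f x * \1_(A n) x).
  by apply: measurable_funM => //; exact: measurable_indic.
have ind0 n x : 0 <= \1_(A n) x :> R by rewrite indicE.
have -> : (fun n => lint (fun x => (f x * \1_(A n) x)%:E)) =
    (fun n => \int[nu]_x (f x * \1_(A n) x)%:E)%E.
  by apply/funext => n; rewrite (representsE Hnu)// => x; rewrite mulr_ge0.
have [] := @dominated_convergence _ _ _ nu setT measurableT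
  (fun n x => (f x * \1_(A n) x)%:E) (cst 0%E) (EFin \o f).
- by move=> n; exact/measurable_EFinP.
- exact: measurable_cst.
- apply: aeW => x _; apply: cvg_near_cst; near=> n.
  by rewrite indicE memNset ?mulr0//; near: n.
- apply/integrableP; split; first exact/measurable_EFinP.
  under eq_integral => x _ do rewrite gee0_abs ?lee_fin//.
  by rewrite -(representsE Hnu)// [X in (X < _)%E]f1 ltry.
- apply: aeW => x n _; rewrite /= lee_fin ger0_norm ?mulr_ge0//.
  by rewrite indicE; case: (_ \in _); rewrite ?mulr1 ?mulr0.
by move=> _ _; rewrite integral0.
Unshelve. all: by end_near. Qed.

(** * Densities whose support has reach zero *)

Section slabs.
Context (R : realType) (d : nat) (i0 : 'I_d).

Let a k : R := k.+1%:R^-1.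

(** As [a k] is 1/(k+1), gap [k] is the open interval from 1/(2k+2) to 1/(2k+1); between gaps [k.+1]
    and [k] the closed interval from 1/(2k+3) to 1/(2k+2) is kept. *)
Definition gaps m : set R :=
  [set t | exists2 k, (m <= k)%N & a k.*2.+1 < t < a k.*2].

Definition slabs m : set (d.-tuple R) := [set y | gaps m (tnth y i0)].

(** Points of the axis [i0], on which the Euclidean distance is that of the line. *)
Definition pt (t : R) : d.-tuple R := [tuple if i == i0 then t else 0 | i < d].

Let a_gt0 k : 0 < a k. Proof. by rewrite invr_gt0 ltr0n. Qed.

Let a_le k l : (k <= l)%N -> a l <= a k.
Proof. by move=> kl; rewrite lef_pV2 ?posrE ?ltr0n// ler_nat. Qed.

Let a_lt k l : (k < l)%N -> a l < a k.
Proof. by move=> kl; rewrite ltf_pV2 ?posrE ?ltr0n// ltr_nat. Qed.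

Let pt_i0 t : tnth (pt t) i0 = t.
Proof. by rewrite tnth_mktuple eqxx. Qed.

Let edist_pt s t : edist (pt s) (pt t) = `|s - t|.
Proof.
rewrite /edist (bigD1 i0)//= !pt_i0 big1 ?addr0 ?sqrtr_sqr// => i ii0.
by rewrite !tnth_mktuple (negbTE ii0) subrr expr0n.
Qed.

Lemma measurable_slabs m : measurable (slabs m).
Proof.
have -> : slabs m = \bigcup_(k in [set k | (m <= k)%N])
    ((fun y => tnth y i0) @^-1` `]a k.*2.+1, a k.*2[%classic).
  apply/seteqP; split=> [y [k mk ky]|y [k mk /=]]; rewrite ?in_itv/=.
    by exists k => //=; rewrite in_itv.
  by move=> ky; exists k.
apply: bigcup_measurable => k _; rewrite -[X in measurable X]setTI.
by apply: (measurable_coord i0) => //; exact: measurable_itv.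
Qed.

(** The slabs of index at least [m] lie strictly between the levels 0 and [a m], and [a m] tends to
    0. *)
Lemma slabs_vanish x : \forall m \near \oo, ~ slabs m x.
Proof.
have [x0|x0] := leP (tnth x i0) 0.
  near=> m; move=> [k _ /andP[+ _]]; apply/negP; rewrite -leNgt.
  exact: le_trans x0 (ltW (a_gt0 _)).
near=> m; move=> [k mk /andP[_]]; apply/negP; rewrite -leNgt.
rewrite (@le_trans _ _ (a m))// ?a_le// ?(leq_trans mk)// -?addnn ?leq_addr//.
by rewrite ltW//; near: m; exact: (near_infty_natSinv_lt (PosNum x0)).
Unshelve. all: by end_near. Qed.

(** The gaps [k <= j] lie above [a j.*2.+1], the gaps [k > j] below [a j.*2.+2]. *)
Let gap_free_between m j t : a j.*2.+2 < t < a j.*2.+1 -> ~ gaps m t.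
Proof.
move=> /andP[tl tu] [k _ /andP[kl ku]]; have [kj|jk] := leqP k j.
  have := a_le (_ : (k.*2.+1 <= j.*2.+1)%N); rewrite ltnS leq_double => /(_ kj).
  by rewrite leNgt (lt_trans kl).
have := a_le (_ : (j.*2.+2 <= k.*2)%N); rewrite -doubleS leq_double => /(_ jk).
by rewrite leNgt (lt_trans tl).
Qed.

Lemma reach_supp_off_slabs (f : d.-tuple R -> R) m : measurable_fun setT f ->
  (forall x, 0 <= f x) -> (forall x, slabs m x -> f x = 0) ->
  (forall x, ~ slabs m x -> 0 < f x) -> reach (supp f) = 0%E.
Proof.
move=> mf f0 fslab fpos.
(* An axis point in the closure of a gap-free interval is in the support, endpoints included; this
   will give the faces of the slabs and the origin. *)
have supp_pt l u s : l < u -> l <= s <= u ->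
    (forall t, l < t < u -> ~ gaps m t) -> supp f (pt s).
  move=> lu /andP[ls su] free; apply: supp_gt0 => // r r0.
  pose e := r / d.+1%:R; have e0 : 0 < e by rewrite divr_gt0.
  have [s' [rho [rho0 ss' rho_free]]] : exists s' rho, [/\ 0 < rho, `|s - s'| < e &
      forall t, `|s' - t| < rho -> l < t < u].
    pose w := Num.min 1 (e / (u - l)); pose mid := (l + u) / 2.
    have ul0 : 0 < u - l by rewrite subr_gt0.
    have w0 : 0 < w by rewrite lt_min ltr01 divr_gt0.
    have w1 : w <= 1 by rewrite ge_min lexx.
    have we : w * (u - l) <= e by rewrite -ler_pdivlMr// ge_min lexx orbT.
    (* The homothety of centre [s] and ratio [w <= 1] maps the interval from [l] to [u] into itself;
       [s'] and [rho] are the centre and half-length of the image, and [w] is small enough to keep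
       [s'] within [e] of [s]. *)
    exists (s + w * (mid - s)), (w * ((u - l) / 2)); split.
    - by rewrite !mulr_gt0// invr_gt0.
    - rewrite ltr_norml /mid; apply/andP; split; nra.
    - move=> t; rewrite ltr_norml /mid => /andP[h1 h2]; apply/andP; split; nra.
  exists (pt s'), (Num.min rho (e - `|s - s'|)); split.
  - by rewrite lt_min rho0 subr_gt0.
  - move=> y /= ys; apply: sub_cube_oball => // i.
    have := ys i; rewrite lt_min => /andP[_]; rewrite ltrBrDl -/e.
    apply: le_lt_trans; rewrite (le_trans (ler_distD (tnth (pt s') i) _ _))// lerD2r.
    by rewrite !tnth_mktuple; case: ifP => // _; rewrite subrr normr0.
  - move=> y ys; apply: fpos; apply: free; apply: rho_free.
    by have := ys i0; rewrite lt_min pt_i0 => /andP[].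
(* Slabs are open: the ball reaching to the nearer face stays inside, where [f] vanishes. *)
have supp_slab y : supp f y -> ~ slabs m y.
  move=> fy [k mk /andP[kl ku]].
  pose r := Num.min (tnth y i0 - a k.*2.+1) (a k.*2 - tnth y i0).
  have r0 : 0 < r by rewrite lt_min !subr_gt0 kl.
  have [z yz /eqP fz] := supp_not0 r0 fy; apply: fz; apply: fslab; exists k => //.
  have := le_lt_trans (coord_le_edist y z i0) yz.
  rewrite lt_min => /andP[]; rewrite !ltr_norml => /andP[_ h1] /andP[h2 _].
  by apply/andP; split; lra.
apply: (reach_eq0 (x := pt 0)).
  (* All gaps are positive, so the origin closes the free interval from -1 to 0. *)
  apply: (supp_pt (-1) 0) => //; rewrite ?ltrN10 ?lexx ?lerN10//.
  move=> t /andP[_ t0] [k _ /andP[kt _]].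
  by have := lt_trans (lt_trans (a_gt0 _) kt) t0; rewrite ltxx.
move=> r r0.
have [j mj jr] : exists2 j, (m <= j)%N & a j < r.
  near \oo => j; exists j; first by near: j; exact: nbhs_infty_ge.
  by near: j; exact: (near_infty_natSinv_lt (PosNum r0)).
(* Gap [j.+1] rather than [j], so that a free interval, up to [a j.*2.+1], always borders it from
   above. *)
pose lo := a j.+1.*2.+1; pose hi := a j.+1.*2; pose c := (lo + hi) / 2.
have lohi : lo < hi by exact: a_lt.
have supp_lo : supp f (pt lo).
  apply: (supp_pt (a j.+1.*2.+2) lo); first exact: a_lt.
    by rewrite lexx andbT ltW//; exact: a_lt.
  exact: gap_free_between.
have supp_hi : supp f (pt hi).
  apply: (supp_pt hi (a j.*2.+1)); first by apply: a_lt; rewrite doubleS.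
    by rewrite lexx/= ltW//; apply: a_lt; rewrite doubleS.
  by move=> t; rewrite /hi doubleS; exact: gap_free_between.
have c_lo : `|c - lo| = (hi - lo) / 2.
  by rewrite ger0_norm; rewrite /c; lra.
have c_hi : `|c - hi| = (hi - lo) / 2.
  by rewrite ler0_norm; rewrite /c; lra.
exists (pt c).
  rewrite edist_pt sub0r normrN ger0_norm; last first.
    by rewrite divr_ge0// addr_ge0// ltW// a_gt0.
  rewrite (@lt_le_trans _ _ hi)//; first by rewrite /c; lra.
  by rewrite (le_trans _ (ltW jr))// a_le// (leq_trans (leqnSn j))// -addnn leq_addr.
(* The support avoids the slab, so along coordinate [i0] it stays half a width away from the
   midpoint; [pt lo] and [pt hi] attain this bound. *)
have far z : supp f z -> (hi - lo) / 2 <= edist (pt c) z.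
  move=> /supp_slab zs; apply: le_trans (coord_le_edist _ _ i0); rewrite pt_i0.
  rewrite leNgt; apply/negP; rewrite ltr_norml => /andP[h1 h2]; apply: zs.
  exists j.+1; first exact: leqW.
  by rewrite -/lo -/hi; move: h1 h2; rewrite /c => h1 h2; apply/andP; split; lra.
move=> [y [_ yuniq]].
have ylo : y = pt lo.
  by apply: yuniq; split => // z /far; rewrite edist_pt c_lo.
have yhi : y = pt hi.
  by apply: yuniq; split => // z /far; rewrite edist_pt c_hi.
by move: lohi; rewrite -[lo]pt_i0 -[hi]pt_i0 -ylo -yhi ltxx.
Unshelve. all: by end_near. Qed.

End slabs.

(** Half of [eps] pays for making the density positive, so that the complement of the slabs is
    exactly its positivity set after the removal; the other half pays for the removal. *)
Lemma approx_reach0 (R : realType) d (hd : (0 < d)%N) (f : d.-tuple R -> R)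
    (eps : R) : is_density f -> 0 < eps ->
  exists g, [/\ is_density g, (L1dist f g < eps%:E)%E & reach (supp g) = 0%E].
Proof.
move=> df e0; pose i0 := Ordinal hd.
have e2 : 0 < eps / 2 by rewrite divr_gt0.
have [g [dg fg gpos]] := approx_positive_density df e2.
pose mass n := lint (fun x => (g x * \1_(slabs i0 n) x)%:E).
have mass0 : mass @ \oo --> 0%E.
  exact: lint_shrinking dg (measurable_slabs i0) (slabs_vanish i0).
(* Removal costs twice the mass, hence [eps / 4]; the bound [2^-1] keeps the mass below 1 for the
   renormalisation. *)
have [n massn] : exists n, (mass n < (Num.min (eps / 4) 2^-1)%:E)%E.
  near \oo => n; exists n; near: n; apply: cvge0_lt => //.
  by rewrite lt_min divr_gt0//= invr_gt0.
have [mg g0 _] := dg; have [nu Hnu] := lint_represents R d.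
have massn0 : (0 <= mass n)%E.
  apply: (represents_ge0 Hnu) => [|x].
    by apply: measurable_funM => //; apply: measurable_indic; exact: measurable_slabs.
  by rewrite mulr_ge0// indicE.
have massE : mass n = (fine (mass n))%:E.
  by rewrite fineK// ge0_fin_numE// (lt_trans massn)// ltry.
move: massn; rewrite massE lte_fin lt_min => /andP[mass4 mass2].
have mass1 : fine (mass n) < 1.
  by rewrite (lt_trans mass2)// invf_lt1 ?ltr0n// ltr1n.
have [dh gh] := restrict_density dg (measurable_slabs i0 n) massE mass1.
have k0 : 0 < (1 - fine (mass n))^-1 by rewrite invr_gt0 subr_gt0.
set h := fun x => _ in dh gh; exists h; split => //.
- have [mf _ _] := df; have [mh _ _] := dh.
  apply: le_lt_trans (L1dist_triangle mf mg mh) _.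
  rewrite [eps]splitr EFinD lte_leD//; last first.
    by rewrite (le_trans gh)// lee_fin; lra.
  rewrite ge0_fin_numE; first by rewrite (le_lt_trans gh)// ltry.
  by apply: (represents_ge0 Hnu) => //; exact: measurable_L1.
- have [mh h0 _] := dh; apply: (@reach_supp_off_slabs _ _ i0 h n mh h0) => x xs.
    by rewrite /h indicE in_setC mem_set//= !mulr0.
  by rewrite /h indicE in_setC memNset//= mulr1 mulr_gt0.
Unshelve. all: by end_near. Qed.

(** * Completeness of L1 and estimability *)

(** If the increments are absolutely summable, [v] converges and the limit superior is its limit,
    reached by telescoping from [v m]; otherwise the right-hand side is infinite. *)
Lemma dist_limn_esup_le (R : realType) (v : nat -> R) m :
  (`|v m - fine (limn_esup (fun k => (v k)%:E))|%:E <=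
   \sum_(0 <= n <oo) `|v (m + n).+1 - v (m + n)%N|%:E)%E.
Proof.
set w := fun n => v (m + n).+1 - v (m + n)%N.
have w0 k : (0 <= k)%N -> true -> (0 <= `|w k|%:E)%E by rewrite lee_fin.
case E : (\sum_(0 <= n <oo) _)%E => [S| |].
- have wS n : \sum_(0 <= i < n) `|w i| <= S.
    by rewrite -lee_fin -E -sumEFin; exact: nneseries_lim_ge.
  have wE n : series w n = v (m + n)%N - v m.
    rewrite /series/= (eq_bigr (fun k => v (m + k.+1)%N - v (m + k)%N)).
      by rewrite (telescope_sumr (fun k => v (m + k)%N))// addn0.
    by move=> k _; rewrite addnS.
  have cnw : cvgn [normed series w].
    apply: nondecreasing_is_cvgn; last by exists S => _ [n _ <-]; exact: wS.
    apply/nondecreasing_seqP => n.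
    by rewrite /normed_series_of /series /= big_nat_recr//= lerDl.
  have cw := normed_cvg cnw.
  have vl : v @ \oo --> limn (series w) + v m.
    rewrite -(cvg_shiftn m).
    rewrite (_ : (fun n => v (n + m)%N) = fun n => series w n + v m).
      by apply: cvgD => //; exact: cvg_cst.
    by apply/funext => n; rewrite wE subrK addnC.
  have -> : limn_esup (fun k => (v k)%:E) = (limn (series w) + v m)%:E.
    apply: (cvg_limn_einf_sup _).2.
    by apply: cvg_EFin => //; apply: nearW.
  rewrite /= lee_fin distrC addrK.
  rewrite (le_trans (lim_series_norm cnw))//.
  by apply: limr_le => //; apply: nearW => n; exact: wS.
- exact: leey.
- have := @nneseries_ge0 R (fun n => `|w n|%:E) xpredT 0 w0.
  by rewrite E.
Qed.

Section L1_complete.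
Context d (T : measurableType d) (R : realType).
Context (I : (T -> \bar R) -> \bar R) (mu : {measure set T -> \bar R}).
Hypothesis Imu : represents I mu.

(* The limit superior spares the almost everywhere argument: where the series of
   increments diverges, the bound of [dist_limn_esup_le] is trivial. *)
Lemma L1_complete (f_ : nat -> T -> R) (delta : nat -> R) :
  (forall k, measurable_fun setT (f_ k)) -> (forall k x, 0 <= f_ k x) ->
  (forall k, 0 <= delta k) -> (forall k, delta k.+1 <= delta k / 2) ->
  (forall k, (I (fun x => `|f_ k x - f_ k.+1 x|%:E) <= (delta k / 2)%:E)%E) ->
  exists f : T -> R, [/\ measurable_fun setT f, forall x, 0 <= f x &
    forall m, (I (fun x => `|f_ m x - f x|%:E) <= (delta m)%:E)%E].
Proof.
move=> mf f0 d0 dd fd.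
(* The absolute value makes the limit nonnegative; since [f_ m] is nonnegative, it does not increase
   the distance to [f_ m]. *)
pose f x : R := `|fine (limn_esup (fun k => (f_ k x)%:E))|.
have mlim : measurable_fun setT (fun x => limn_esup (fun k => (f_ k x)%:E)).
  by apply: measurable_fun_limn_esup => k; exact/measurable_EFinP.
have mf' : measurable_fun setT f.
  apply: measurableT_comp => //.
  by apply: (measurableT_comp _ mlim); exact: fine_measurable.
exists f; split => [//|x|m]; first exact: normr_ge0.
pose u n x : R := `|f_ (m + n).+1 x - f_ (m + n)%N x|.
have u0 n x : 0 <= u n x by exact: normr_ge0.
have mu' n : measurable_fun setT (u n).
  by apply: measurableT_comp => //; exact: measurable_funB.
have mfm : measurable_fun setT (fun x => `|f_ m x - f x|).
  by apply: measurableT_comp => //; exact: measurable_funB.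
rewrite (representsE Imu)//.
apply: (@le_trans _ _ (\int[mu]_x \sum_(0 <= n <oo) (u n x)%:E)%E).
  apply: ge0_le_integral => //.
  - by apply/measurable_EFinP; exact: mfm.
  - apply: ge0_emeasurable_sum => // [k x _ _|k _]; first by rewrite lee_fin.
    exact/measurable_EFinP.
  - move=> x _; apply: le_trans (dist_limn_esup_le (f_ ^~ x) m).
    by rewrite lee_fin -{1}(ger0_norm (f0 m x)) ler_dist_dist.
rewrite integral_nneseries//; last 2 first.
- by move=> n; exact/measurable_EFinP.
- by move=> n x _; rewrite lee_fin.
apply: lime_le.
  apply: is_cvg_nneseries => n _ _.
  by apply: integral_ge0 => x _; rewrite lee_fin.
apply: nearW => n.
(* Halving gives [delta k / 2 <= delta k - delta k.+1], so the partial sums telescope. *)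
apply: (@le_trans _ _ (delta m - delta (m + n)%N)%:E); last first.
  by rewrite lee_fin lerBlDr lerDl.
elim: n => [|n IHn]; first by rewrite big_geq// addn0 subrr.
rewrite big_nat_recr//=.
apply: (@le_trans _ _ ((delta m - delta (m + n)%N)%:E + (delta (m + n)%N / 2)%:E)%E).
  rewrite leeD//; apply: le_trans (fd (m + n)%N).
  rewrite (representsE Imu)//; last first.
    by apply: measurableT_comp => //; exact: measurable_funB.
  by under eq_integral do rewrite /u distrC.
rewrite -EFinD lee_fin addnS; have := dd (m + n)%N; lra.
Qed.

End L1_complete.

(** The integral of [f] differs from 1 by at most [delta k]. The two inequalities are proved
    separately because finiteness of the integral is drawn from the upper one. *)
Lemma L1_limit_density (R : realType) d (f_ : nat -> d.-tuple R -> R)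
    (f : d.-tuple R -> R) (delta : nat -> R) :
  (forall k, is_density (f_ k)) -> measurable_fun setT f ->
  (forall x, 0 <= f x) -> (forall k, (L1dist (f_ k) f <= (delta k)%:E)%E) ->
  (forall e, 0 < e -> exists k, delta k < e) -> is_density f.
Proof.
move=> df mf f0 fd d0; split => //; have [nu Hnu] := lint_represents R d.
have intf0 := represents_ge0 Hnu mf f0.
have ub k : (lint (fun x => (f x)%:E) <= (1 + delta k)%:E)%E.
  have [mk k0 k1] := df k.
  rewrite EFinD -k1; apply: (@le_trans _ _
    (lint (fun x => (f_ k x)%:E) + L1dist (f_ k) f)%E); last by rewrite leeD2l.
  rewrite /L1dist -(representsD Hnu)//; last exact: measurable_L1.
  apply: (represents_le Hnu) => //.
    by apply: measurable_funD => //; exact: measurable_L1.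
  by move=> x; rewrite -lerBlDl distrC ler_norm.
have lb k : (1 <= lint (fun x => (f x)%:E) + (delta k)%:E)%E.
  have [mk k0 k1] := df k.
  rewrite -k1; apply: (@le_trans _ _
    (lint (fun x => (f x)%:E) + L1dist (f_ k) f)%E); last by rewrite leeD2l.
  rewrite /L1dist -(representsD Hnu)//; last exact: measurable_L1.
  apply: (represents_le Hnu) => //.
    by apply: measurable_funD => //; exact: measurable_L1.
  by move=> x; rewrite -lerBlDl ler_norm.
have : lint (fun x => (f x)%:E) \is a fin_num.
  by rewrite ge0_fin_numE// (le_lt_trans (ub 0%N))// ltry.
case: (lint _) ub lb => // r ub lb _; congr EFin; apply/eqP; rewrite eq_le.
apply/andP; split; rewrite leNgt; apply/negP => lt1.
- have r1 : 0 < r - 1 by rewrite subr_gt0.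
  by have [k rk] := d0 _ r1; have := ub k; rewrite lee_fin; lra.
- have r1 : 0 < 1 - r by rewrite subr_gt0.
  by have [k rk] := d0 _ r1; have := lb k; rewrite -EFinD lee_fin; lra.
Qed.

(** * Error probabilities of an estimator *)

Section error_probability.
Context (R : realType) (d n : nat) (S : n.-tuple (d.-tuple R) -> R).
Hypothesis mS : measurable_fun setT S.
Implicit Types f g : d.-tuple R -> R.

(** The target [b] is decoupled from the density [f], so that one target can be tested under several
    densities. *)
Definition error_prob (eps b : R) (f : d.-tuple R -> R) : \bar R :=
  tint (@lint R d) (fun xs : n.-tuple (d.-tuple R) =>
    (if eps < `|S xs - b| then \prod_(i < n) f (tnth xs i) else 0)%:E).

Lemma measurable_error (eps b : R) f : measurable_fun setT f ->
  measurable_fun setT (fun xs : n.-tuple (d.-tuple R) =>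
    if eps < `|S xs - b| then \prod_(i < n) f (tnth xs i) else 0).
Proof.
move=> mf; apply: measurable_fun_ifT => //.
  apply: measurable_fun_ltr => //; apply: measurableT_comp => //.
  exact: measurable_funB.
exact: (measurable_tnth_prod (h := fun=> f)).
Qed.

(** On the error event the integrands differ by at most the distance of the product densities,
    elsewhere both vanish. *)
Lemma error_prob_dist (eps b l : R) f g : is_density f -> is_density g ->
  (L1dist f g <= l%:E)%E ->
  (error_prob eps b g <= error_prob eps b f + (n%:R * l)%:E)%E.
Proof.
move=> [mf f0 f1] [mg g0 g1] fgl; have [nu Hnu] := lint_represents R d.
have [nun Hnun] := tint_represents Hnu n.
have mfg : measurable_fun setT (fun xs : n.-tuple (d.-tuple R) =>
    `|\prod_(i < n) f (tnth xs i) - \prod_(i < n) g (tnth xs i)|).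
  apply: measurableT_comp => //; apply: measurable_funB.
    exact: (measurable_tnth_prod (h := fun=> f)).
  exact: (measurable_tnth_prod (h := fun=> g)).
have prod0 (h : d.-tuple R -> R) (xs : n.-tuple (d.-tuple R)) :
    (forall x, 0 <= h x) -> 0 <= \prod_(i < n) h (tnth xs i).
  by move=> h0; apply: prodr_ge0.
have mef := measurable_error eps b mf; have meg := measurable_error eps b mg.
have ef0 (h : d.-tuple R -> R) xs : (forall x, 0 <= h x) -> 0 <=
    if eps < `|S xs - b| then \prod_(i < n) h (tnth xs i) else 0.
  by move=> h0; case: ifP => // _; exact: prod0.
apply: le_trans (leeD2l _ (tint_prod_dist n Hnu mf f0 f1 mg g0 g1 fgl)).
rewrite /error_prob -(representsD Hnun)//; last by move=> xs; exact: ef0.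
apply: (represents_le Hnun) => //.
- exact: measurable_funD.
- by move=> xs; exact: ef0.
- move=> xs; case: ifP => _; last by rewrite add0r.
  by rewrite -lerBlDl distrC ler_norm.
Qed.

(** No value lies within [eps] of both [a] and [b], so the two error events cover the sample
    space. *)
Lemma error_prob_sum_ge1 (eps a b : R) f : is_density f -> 2 * eps < `|a - b| ->
  (1 <= error_prob eps a f + error_prob eps b f)%E.
Proof.
move=> [mf f0 f1] ab; have [nu Hnu] := lint_represents R d.
have [nun Hnun] := tint_represents Hnu n.
have prod0 (xs : n.-tuple (d.-tuple R)) : 0 <= \prod_(i < n) f (tnth xs i).
  by apply: prodr_ge0.
have ef0 c xs : 0 <= if eps < `|S xs - c| then \prod_(i < n) f (tnth xs i) else 0.
  by case: ifP.
have me c := measurable_error eps c mf.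
rewrite -(tint_prod_density n Hnu mf f0 f1) /error_prob -(representsD Hnun)//.
apply: (represents_le Hnun) => //.
- exact: (measurable_tnth_prod (h := fun=> f)).
- exact: measurable_funD.
move=> xs; case: ifPn => [_|]; first by rewrite lerDl.
rewrite -leNgt => Sa; case: ifPn => [_|]; first by rewrite add0r.
rewrite -leNgt => Sb; move: ab; rewrite ltNge; case/negP.
rewrite (le_trans (ler_distD (S xs) _ _))// distrC mulrDl mul1r; exact: lerD.
Qed.

End error_probability.

(** * Impossibility of consistent estimation *)

Lemma not_consistently_estimable (R : realType) d
    (Phi : (d.-tuple R -> R) -> R) :
  (exists f : d.-tuple R -> R, is_density f) ->
  (forall f, is_density f -> Phi f = 0 \/ Phi f = 1) ->
  (forall f, is_density f -> forall e : R, 0 < e -> exists g,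
     [/\ is_density g, (L1dist f g < e%:E)%E & Phi g = 1 - Phi f]) ->
  ~ consistently_estimable Phi.
Proof.
move=> [f0 df0] Phi01 flip [S [mS cons]].
(* Accuracy 1/4 separates the values 0 and 1, as twice it is less than 1. *)
pose err n := error_prob (S n) 4^-1.
have err0 f (e : R) : is_density f -> 0 < e ->
    \forall n \near \oo, (err n (Phi f) f < e%:E)%E.
  move=> df e0; apply: cvge0_lt => //.
  by apply: cons => //; rewrite invr_gt0.
(* A state consists of a density, a sample size [n] and a tolerance for all later changes; the last
   clause gives [n * delta <= 1/4], with [n.+1] in the denominator since [n] may be 0. *)
pose inv (k : nat) (s : (d.-tuple R -> R) * nat * R) :=
  [/\ is_density s.1.1, (k <= s.1.2)%N,
      (err s.1.2 (Phi s.1.1) s.1.1 < (4^-1)%:E)%E,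
      0 < s.2 & s.2 <= 4^-1 / s.1.2.+1%:R].
have start f k (D : R) : is_density f -> 0 < D ->
    exists n delta, inv k (f, n, delta) /\ delta <= D.
  move=> df D0.
  have [n kn errn] : exists2 n, (k <= n)%N & (err n (Phi f) f < (4^-1)%:E)%E.
    near \oo => n; exists n; first by near: n; exact: nbhs_infty_ge.
    by near: n; apply: err0 => //; rewrite invr_gt0.
  exists n, (Num.min (4^-1 / n.+1%:R) D); split; last by rewrite ge_min lexx orbT.
  split => //=; last by rewrite ge_min lexx.
  by rewrite lt_min D0 andbT divr_gt0.
(* The invariant is a premise inside [step], because dependent choice requires a successor of every
   state; the counter gives the index of the invariant. *)
pose step (s s' : nat * ((d.-tuple R -> R) * nat * R)) :=
  s'.1 = s.1.+1 /\ (inv s.1 s.2 -> [/\ inv s'.1 s'.2,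
    Phi s'.2.1.1 = 1 - Phi s.2.1.1,
    (L1dist s.2.1.1 s'.2.1.1 <= (s.2.2 / 2)%:E)%E & s'.2.2 <= s.2.2 / 2]).
have step_ex s : {s' | step s s'}.
  apply: cid; case: s => k [[f n] delta].
  have [[df _ _ delta0 _]|Ninv] := pselect (inv k (f, n, delta)); last first.
    by exists (k.+1, (f, n, delta)); split.
  have d2 : 0 < delta / 2 by rewrite divr_gt0.
  have [g [dg fg Pg]] := flip f df _ d2.
  have [n' [delta' [invg dd]]] := start g k.+1 _ dg d2.
  by exists (k.+1, (g, n', delta')); split => //= _; split => //; exact: ltW.
have [n0 [delta0 [inv0 _]]] := start f0 0%N 1 df0 ltr01.
have [s [s0 sstep]] := dependent_choice step_ex (0%N, (f0, n0, delta0)).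
have s1 k : (s k).1 = k.
  by elim: k => [|k IHk]; rewrite ?s0// (sstep k).1 IHk.
have inv_s k : inv k (s k).2.
  elim: k => [|k IHk]; first by rewrite s0.
  by have := (sstep k).2; rewrite !s1 => /(_ IHk) [].
pose f_ k := (s k).2.1.1; pose n_ k := (s k).2.1.2; pose delta k := (s k).2.2.
have step_s k : [/\ Phi (f_ k.+1) = 1 - Phi (f_ k),
    (L1dist (f_ k) (f_ k.+1) <= (delta k / 2)%:E)%E & delta k.+1 <= delta k / 2].
  by have := (sstep k).2; rewrite !s1 => /(_ (inv_s k)) [].
have df_ k : is_density (f_ k) by have [] := inv_s k.
have kn_ k : (k <= n_ k)%N by have [] := inv_s k.
have err_f k : (err (n_ k) (Phi (f_ k)) (f_ k) < (4^-1)%:E)%E by have [] := inv_s k.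
have delta_gt0 k : 0 < delta k by have [] := inv_s k.
have delta_le k : delta k <= 4^-1 / (n_ k).+1%:R by have [] := inv_s k.
have [nu Hnu] := lint_represents R d.
have [f [mf f_ge0 fd]] : exists f : d.-tuple R -> R, [/\ measurable_fun setT f,
    forall x, 0 <= f x & forall k, (L1dist (f_ k) f <= (delta k)%:E)%E].
  apply: (L1_complete Hnu) => [k|k|k|k|k].
  - by have [] := df_ k.
  - by have [] := df_ k.
  - exact: ltW.
  - by have [] := step_s k.
  - by have [] := step_s k.
have df : is_density f.
  (* The tolerances tend to 0, being at most 1/(k+1) because [k <= n_ k]. *)
  apply: (L1_limit_density df_ mf f_ge0 fd) => e e0.
  near \oo => k; exists k; apply: le_lt_trans (delta_le k) _.
  rewrite (@le_lt_trans _ _ (k.+1%:R^-1))//; last first.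
    by near: k; exact: (near_infty_natSinv_lt (PosNum e0)).
  rewrite -[leRHS]mul1r ler_pM// ?invr_ge0//.
    by rewrite invf_le1 ?ler1n.
  by rewrite lef_pV2 ?posrE ?ltr0n// ler_nat ltnS.
(* Under the limit [f], the error around [Phi (f_ k)] has probability at most 1/4 + 1/4 at sample
   size [n_ k], so the error around the other value has at least 1/2. *)
have half k : ((2^-1)%:E <= err (n_ k) (1 - Phi (f_ k))%R f)%E.
  have le_half : (err (n_ k) (Phi (f_ k)) f <= (2^-1)%:E)%E.
    apply: le_trans (error_prob_dist (mS _) _ _ (df_ k) df (fd k)) _.
    have -> : 2^-1 = 4^-1 + 4^-1 :> R by lra.
    rewrite EFinD; apply: leeD; first exact: ltW (err_f k).
    rewrite lee_fin; apply: (@le_trans _ _ ((n_ k)%:R * (4^-1 / (n_ k).+1%:R))).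
      by rewrite ler_wpM2l.
    by rewrite mulrCA ler_piMr// ler_pdivrMr ?mul1r ?ler_nat.
  have : (1 <= err (n_ k) (Phi (f_ k)) f + err (n_ k) (1 - Phi (f_ k))%R f)%E.
    apply: (error_prob_sum_ge1 (mS _) df).
    case: (Phi01 _ (df_ k)) => ->;
      rewrite ?subr0 ?sub0r ?subrr ?normrN ?subr0 normr1; lra.
  move: le_half; case: (err _ (Phi _) f) => [a| |] ha.
  - case: (err _ _ f) => [b| |] hb; last 2 first.
    + by rewrite leey.
    + by move: hb; rewrite addeNy leeNy_eq.
    by move: ha hb; rewrite -EFinD !lee_fin; lra.
  - by move: ha; rewrite leye_eq.
  - by rewrite addNye leeNy_eq.
have half_gt0 : 0 < 2^-1 :> R by rewrite invr_gt0.
have [N _ errN] := err0 f 2^-1 df half_gt0.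
have good k : (N <= k)%N -> 1 - Phi (f_ k) = Phi f -> False.
  move=> Nk Pk; have := half k; rewrite Pk leNgt => /negP; apply.
  by apply: errN; exact: leq_trans Nk (kn_ k).
(* The values alternate, so [f_ N] or [f_ N.+1] has the value opposite to [Phi f], which [good]
   excludes. *)
have [P1 _ _] := step_s N.
case: (Phi01 _ (df_ N)) (Phi01 _ df) => PN [] Pf.
- by apply: (good N.+1) => //; rewrite P1 PN Pf; lra.
- by apply: (good N) => //; rewrite PN Pf; lra.
- by apply: (good N) => //; rewrite PN Pf; lra.
- by apply: (good N.+1) => //; rewrite P1 PN Pf; lra.
Unshelve. all: by end_near. Qed.

(** * The indicator of vanishing reach *)

Lemma alpha_reach0 (R : realType) d (f : d.-tuple R -> R) :
  reach (supp f) = 0%E -> alpha f = 1.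
Proof. by move=> r0; rewrite /alpha r0 eqxx. Qed.

Lemma alpha_reach_gt0 (R : realType) d (f : d.-tuple R -> R) :
  (0 < reach (supp f))%E -> alpha f = 0.
Proof. by move=> r0; rewrite /alpha gt_eqF. Qed.

Lemma reach0_or_gt0 (R : realType) d (M : set (d.-tuple R)) :
  reach M = 0%E \/ (0 < reach M)%E.
Proof.
by have := reach_ge0 M; rewrite le_eqVlt => /orP[/eqP <-|]; [left|right].
Qed.

Lemma alpha_flip (R : realType) d (hd : (0 < d)%N) (f : d.-tuple R -> R)
    (e : R) : is_density f -> 0 < e -> exists g,
  [/\ is_density g, (L1dist f g < e%:E)%E & alpha g = 1 - alpha f].
Proof.
move=> df e0; have [r0|rp] := reach0_or_gt0 (supp f).
  have [g [dg fg gpos]] := approx_positive_density df e0.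
  exists g; split => //; rewrite (alpha_reach0 r0) alpha_reach_gt0 ?subrr//.
  by rewrite supp_full//; exact: reach_setT_gt0.
have [g [dg fg rg]] := approx_reach0 hd df e0.
by exists g; split => //; rewrite (alpha_reach_gt0 rp) alpha_reach0 ?subr0.
Qed.

Theorem theorem3 (R : realType) (d : nat) (hd : (0 < d)%N) :
  (* (i) *)
  (forall f : d.-tuple R -> R, is_density f -> (0 < reach (supp f))%E ->
     forall delta : R, 0 < delta ->
     exists fd, is_density fd /\ (L1dist f fd < delta%:E)%E /\
                reach (supp fd) = 0%E) /\
  (* (ii) *)
  (forall f : d.-tuple R -> R, is_density f -> reach (supp f) = 0%E ->
     forall eps : R, 0 < eps ->
     exists fe, is_density fe /\ (L1dist f fe < eps%:E)%E /\
                (0 < reach (supp fe))%E) /\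
  (* alpha is L^1-discontinuous at every density *)
  (forall f : d.-tuple R -> R, is_density f ->
     ~ (forall eps : R, 0 < eps -> exists2 delta : R, 0 < delta &
          forall g, is_density g -> (L1dist f g < delta%:E)%E ->
            `|alpha g - alpha f| < eps)) /\
  (* alpha is not consistently estimable *)
  ~ consistently_estimable (@alpha R d).
Proof.
split; [|split; [|split]].
- move=> f df _ delta delta0.
  by have [g [dg fg rg]] := approx_reach0 hd df delta0; exists g.
- move=> f df _ eps eps0.
  have [g [dg fg gpos]] := approx_positive_density df eps0; exists g.
  by rewrite supp_full//; do 2 split => //; exact: reach_setT_gt0.
(* A flip changes [alpha] by exactly 1, so continuity already fails for the tolerance 1. *)
- move=> f df /(_ 1 ltr01) [delta delta0 cont].
  have [g [dg fg Pg]] := alpha_flip hd df delta0.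
  have := cont g dg fg; rewrite Pg /alpha; case: ifP => _.
    by rewrite subrr sub0r normrN normr1 ltxx.
  by rewrite !subr0 normr1 ltxx.
- apply: not_consistently_estimable.
  + by exists (@gauss R d); exact: gauss_density.
  + by move=> f _; rewrite /alpha; case: ifP => _; [right|left].
  + by move=> f df e; exact: alpha_flip.
Qed.
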